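(* Let $\mathcal{K}_1,\dots,\mathcal{K}_\ell$ be hyperbolicity cones in a Euclidean space $\mathcal{E}$, with hyperbolic polynomials $p_1,\dots,p_\ell$ of degrees $n_1,\dots,n_\ell$. Assume $e\in\mathrm{int}(\mathcal{K}_i)$ for all $i$. For $x\in\mathcal{E}$ let $\{\lambda_{ij}(x):j=1,\dots,n_i\}$ be the roots (with multiplicity) of $\lambda\mapsto p_i(x-\lambda e)$, and for $\mu>0$ let $$f_{i,\mu}(x):=\mu\ln\sum_{j=1}^{n_i}\exp(\lambda_{ij}(x)/\mu).$$ Let $\mathcal{K}:=\bigcap_i\mathcal{K}_i$, for which a hyperbolic polynomial is the product $p=p_1\cdots p_\ell$. Then for every $x\in\mathcal{E}$ the set of eigenvalues of $x$ corresponding to $p$ and $e$ (the roots of $\lambda\mapsto p(x-\lambda e)$, with multiplicity) is $\bigcup_{i=1}^\ell\{\lambda_{ij}(x):j=1,\dots,n_i\}$ (union as multisets), and the corresponding smooth function $f_\mu(x):=\mu\ln\sum_{\lambda}\exp(\lambda/\mu)$, the sum running over all these eigenvalues $\lambda$ of $x$ with multiplicity, satisfies $$\nabla f_\mu(x)=\frac{1}{\sum_{i=1}^\ell\left(\sum_{j=1}^{n_i}\exp(\lambda_{ij}(x)/\mu)\right)}\sum_{i=1}^\ell\left(\sum_{j=1}^{n_i}\exp(\lambda_{ij}(x)/\mu)\right)\nabla f_{i,\mu}(x),$$ a convex combination of the gradients $\nabla f_{i,\mu}(x)$.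
   Context: $\mathcal{E}$ is a finite-dimensional real Euclidean space. A closed convex cone $\mathcal{K}\subsetneq\mathcal{E}$ with nonempty interior is a hyperbolicity cone with hyperbolic polynomial $p$ if $p:\mathcal{E}\to\mathbb{R}$ is a real homogeneous polynomial such that (1) $\mathrm{int}(\mathcal{K})$ is a connected component of $\{x:p(x)\neq0\}$, and (2) for some (equivalently, every) $e\in\mathrm{int}(\mathcal{K})$ and all $x\in\mathcal{E}$, the univariate polynomial $\lambda\mapsto p(x-\lambda e)$ has only real roots. *)

(* Defs.v *)
From HB Require Import structures.
From mathcomp Require Import all_boot all_order all_algebra.
From mathcomp Require Import complex.
From mathcomp Require Import all_classical all_reals all_analysis.
(* No notations: they clash with those of analysis. *)
From mathcomp Require Import (canonicals, coercions) mpoly.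

Set Implicit Arguments.
Unset Strict Implicit.
Unset Printing Implicit Defensive.
Import Order.TTheory GRing.Theory Num.Theory.
Import numFieldNormedType.Exports.

Local Open Scope classical_set_scope.
Local Open Scope ring_scope.

(* A vectType is finite-dimensional, so a euclideanType is a finite-dimensional
   real inner product space whose topology is that of the induced norm. *)
#[short(type="normedVectType")]
HB.structure Definition NormedVector (R : realType) :=
  {E of NormedModule R E & Vector R E}.

HB.mixin Record isEuclidean (R : realType) E of NormedVector R E := {
  dot : E -> E -> R;
  dotC : forall x y, dot x y = dot y x;
  dotDl : forall x y z, dot (x + y) z = dot x z + dot y z;
  dotZl : forall a x y, dot (a *: x) y = a * dot x y;
  dot_normE : forall x, dot x x = `|x| ^+ 2 }.

#[short(type="euclideanType")]
HB.structure Definition Euclidean (R : realType) :=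
  {E of NormedVector R E & isEuclidean R E}.

Section Hyperbolicity.
Context {R : realType} {E : euclideanType R}.
Implicit Types (p f : E -> R) (e x : E) (K : set E) (q : {poly R}) (s : seq R).

(* p is a homogeneous polynomial of degree n in the coordinates with respect to
   a basis of E; the zero function is homogeneous of every degree. *)
Definition homogeneous_polynomial (n : nat) p : Prop :=
  exists2 P : mpoly.mpoly (\dim (fullv : {vspace E})) R,
    P \is mpoly.ishomog1 n mpoly.mdeg &
    forall x, p x = mpoly.meval (fun i => coord (vbasis fullv) i x) P.

(* The polynomial in t that takes the values p (x - t e). It exists and is
   unique when p is polynomial; the value 0 is a default. *)
Definition line_poly p e x : {poly R} :=
  xget 0 [set q | forall t : R, q.[t] = p (x - t *: e)].

Definition real_rooted q : Prop :=
  forall z : complex R,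
    root (map_poly (real_complex R) q) z -> complex.Im z = 0.

(* s lists all the complex roots of q, each as often as its multiplicity. *)
Definition roots_with_multiplicity q s : Prop :=
  forall z : complex R,
    count_mem z (map (real_complex R) s) = mup z (map_poly (real_complex R) q).

Definition eigenvalues p e x s : Prop :=
  roots_with_multiplicity (line_poly p e x) s.

Record hyperbolicity_cone (K : set E) (n : nat) (p : E -> R) : Prop := {
  hyp_closed : closed K;
  hyp_convex : convex_set K;
  hyp_cone : forall (a : R) x, 0 <= a -> K x -> K (a *: x);
  hyp_proper : K `<` setT;
  hyp_solid : K° !=set0;
  hyp_homogeneous : homogeneous_polynomial n p;
  hyp_component :
    exists2 x, p x != 0 & K° = connected_component [set y | p y != 0] x;
  hyp_real_rooted :
    exists2 e, K° e & forall x, real_rooted (line_poly p e x) }.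

Definition sum_exp (mu : R) s : R := \sum_(a <- s) expR (a / mu).

Definition log_sum_exp (mu : R) s : R := mu * ln (sum_exp mu s).

(* The Riesz representative of the differential, for f differentiable at x. *)
Definition gradient f x : E :=
  xget 0 [set g | forall v : E, 'd f x v = dot g v].

End Hyperbolicity.

(* Main.v *)
Require Import Defs.
From HB Require Import structures.
From mathcomp Require Import all_boot all_order all_algebra.
From mathcomp Require Import complex.
From mathcomp Require Import all_classical all_reals all_analysis.
From mathcomp Require Import (canonicals, coercions) mpoly.
From mathcomp Require Import ring lra.
Import Order.TTheory GRing.Theory Num.Theory.
Import numFieldNormedType.Exports.
Local Open Scope classical_set_scope.
Local Open Scope ring_scope.

(** The polynomials [t |-> p_i (x - t e)] multiply, so the multisets of
eigenvalues add up, and [exp (f_mu / mu)] is the sum of the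
[S_i = exp (f_(i,mu) / mu)]; the gradient formula is the chain rule. For the
cone, the interior of the intersection is convex, hence connected, and a
connected component of [{p_1 ... p_l <> 0}] lies in one of each [{p_i <> 0}].

The hard point is that [S(y) = sum_j exp (lam_j(y) / mu)] is differentiable at
every [x], although the roots [lam_j] need not be. For a polynomial [H], the sum
[sum_j H(lam_j(y))] is a polynomial in the elementary symmetric functions of the
roots, which are smooth in [y]. Take for [H] the Hermite interpolant of
[exp (. / mu)] with double nodes at the [lam_j(x)]: the error is
[O(sum_j m(lam_j(y))^2)] with [m = prod_i (X - lam_i(x))], which is again such a
polynomial sum, nonnegative and zero at [y = x]. Hence its differential vanishes
at [x], and it squeezes the error to [o(y - x)]. *)

Set Implicit Arguments.
Unset Strict Implicit.
Unset Printing Implicit Defensive.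

(** * Differentials *)

Lemma diff_sum (R : numFieldType) (V W : normedModType R) (I : Type) (r : seq I)
    (F : I -> V -> W) x : (forall i, differentiable (F i) x) ->
  is_diff x (fun y => \sum_(i <- r) F i y)
    (fun v => \sum_(i <- r) 'd (F i) x v).
Proof.
move=> dF; elim: r => [|i r IH].
  have -> : (fun y => \sum_(j <- [::]) F j y) = cst 0.
    by apply/funext => y; rewrite big_nil.
  have -> : (fun v => \sum_(j <- [::]) 'd (F j) x v) = 0.
    by apply/funext => v; rewrite big_nil.
  exact: is_diff_cst.
have -> : (fun y => \sum_(j <- i :: r) F j y) =
    F i + (fun y => \sum_(j <- r) F j y).
  by apply/funext => y; rewrite big_cons.
have -> : (fun v => \sum_(j <- i :: r) 'd (F j) x v) =
    ('d (F i) x : V -> W) + (fun v => \sum_(j <- r) 'd (F j) x v).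
  by apply/funext => v; rewrite big_cons.
by apply: is_diffD => //; exact: differentiableP.
Qed.

Lemma differentiable_bigsum (R : numFieldType) (V W : normedModType R)
    (I : Type) (r : seq I) (F : I -> V -> W) x :
  (forall i, differentiable (F i) x) ->
  differentiable (fun y => \sum_(i <- r) F i y) x.
Proof. by move=> dF; have [] := diff_sum r dF. Qed.

Lemma diff_log (R : realType) (V : normedModType R) (mu : R)
    (g : V -> R) x : differentiable g x -> 0 < g x ->
  differentiable (fun y => mu * ln (g y)) x /\
  forall v, 'd (fun y => mu * ln (g y)) x v = mu / g x * 'd g x v.
Proof.
move=> dg gx.
have dl : is_derive (g x) 1 (@ln R) (g x)^-1 := is_derive1_ln gx.
have dln : differentiable (@ln R) (g x) by apply/derivable1_diffP; case: dl.
have dlg : differentiable (@ln R \o g) x by exact: differentiable_comp.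
have -> : (fun y => mu * ln (g y)) = mu *: (@ln R \o g) by [].
split; first exact: differentiableZ.
move=> v; rewrite (diffZ mu dlg)/= (diff_comp dg dln)/= (diff1E dln)/=.
by rewrite derive1E derive_val /GRing.scale/=; ring.
Qed.

(** * Euclidean spaces *)

Section euclidean.
Context {R : realType} {E : euclideanType R}.
Implicit Types (x y g : E).

Lemma dot0l x : dot 0 x = 0.
Proof. by rewrite -(scale0r 0) dotZl mul0r. Qed.

Lemma dotZr a x y : dot x (a *: y) = a * dot x y.
Proof. by rewrite dotC dotZl dotC. Qed.

Lemma dotDr x y z : dot x (y + z) = dot x y + dot x z.
Proof. by rewrite dotC dotDl !(dotC x). Qed.

Lemma dot_suml n (F : 'I_n -> E) x :
  dot (\sum_i F i) x = \sum_i dot (F i) x.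
Proof.
by apply: (big_morph (fun y => dot y x)) => [y z|]; rewrite ?dotDl ?dot0l.
Qed.

Lemma dot_eq0 x : dot x x = 0 -> x = 0.
Proof. by rewrite dot_normE => /eqP; rewrite sqrf_eq0 normr_eq0 => /eqP. Qed.

Lemma dot_cauchy_schwarz x y : `|dot x y| <= `|x| * `|y|.
Proof.
have [->|y0] := eqVneq y 0; first by rewrite dotC dot0l normr0 mulr_ge0.
have y2 : 0 < `|y| ^+ 2 by rewrite exprn_gt0// normr_gt0.
(* [z] is the component of [x] orthogonal to [y], scaled by the squared norm of [y] to avoid a
   division. *)
pose z := `|y| ^+ 2 *: x + - dot x y *: y.
have : 0 <= dot z z by rewrite dot_normE sqr_ge0.
rewrite /z dotDl !dotDr !dotZl !dotZr !dot_normE (dotC y x) => h.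
rewrite -(@ler_sqr _ `|_|) ?nnegrE ?mulr_ge0// real_normK ?num_real//.
rewrite -subr_ge0 -(pmulr_rge0 _ y2); apply: le_trans h _.
by rewrite le_eqVlt; apply/orP; left; apply/eqP; ring.
Qed.

(** The Gram matrix [G] of a basis is invertible: a row that it kills gives a combination orthogonal
    to the basis, hence to itself. The coordinates of the representative solve the resulting linear
    system. *)
Lemma riesz (phi : {linear E -> R}) : exists g, forall v, phi v = dot g v.
Proof.
pose d := \dim (fullv : {vspace E}); pose b i : E := (vbasis fullv)`_i.
have coordE v : v = \sum_(i < d) coord (vbasis fullv) i v *: b i.
  by rewrite -coord_vbasis ?memvf.
pose G : 'M[R]_d := \matrix_(i, j) dot (b i) (b j).
have GE (c : 'rV_d) j : (c *m G) 0 j = dot (\sum_i c 0 i *: b i) (b j).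
  by rewrite mxE dot_suml; apply: eq_bigr => i _; rewrite mxE dotZl.
have Gu : G \in unitmx.
  rewrite -row_free_unit; apply: inj_row_free => c cG0.
  have : \sum_i c 0 i *: b i = 0.
    apply: dot_eq0; set g := \sum_i _.
    rewrite {2}/g dotC dot_suml big1// => j _.
    by rewrite dotZl dotC -GE cG0 mxE mulr0.
  move=> s0; apply/rowP => j; rewrite mxE.
  have := coord_sum_free (c 0) j (basis_free (vbasisP (fullv : {vspace E}))).
  by rewrite s0 linear0.
pose c := (\row_j phi (b j)) *m invmx G.
exists (\sum_i c 0 i *: b i) => v.
rewrite {1}(coordE v) [in RHS](coordE v) linear_sum dotC dot_suml.
apply: eq_bigr => j _; rewrite linearZ dotZl dotC -GE.
by rewrite /c mulmxKV// mxE.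
Qed.

(** Cauchy-Schwarz applied to the Riesz representative bounds the form. Coordinates are thereby
    differentiable. *)
Lemma dot_linear_continuous (phi : {linear E -> R}) : continuous phi.
Proof.
have [g gE] := riesz phi.
apply: bounded_linear_continuous; apply/ex_bound.
exists (`|g| * 1); apply/nbhs_ballP; exists 1 => //= v.
rewrite -ball_normE /= sub0r normrN => v1; rewrite gE.
by apply: le_trans (dot_cauchy_schwarz _ _) _; rewrite ler_wpM2l// ltW.
Qed.

Lemma gradient_uniq (f : E -> R) x g :
  (forall v, 'd f x v = dot g v) -> gradient f x = g.
Proof.
move=> fg; rewrite /gradient; case: xgetP => [h _ /= hE|/(_ g)]; last by case.
apply/eqP; rewrite -subr_eq0; apply/eqP; apply: dot_eq0.
by rewrite dotDl -scaleN1r dotZl -hE -fg mulN1r subrr.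
Qed.

Lemma gradientE (f : E -> R) x v : 'd f x v = dot (gradient f x) v.
Proof. by have [g gE] := riesz ('d f x); rewrite (gradient_uniq gE). Qed.

Lemma differentiable_linear (phi : {linear E -> R}) x : differentiable phi x.
Proof. exact/linear_differentiable/dot_linear_continuous. Qed.

(** First-order optimality: a negative derivative along [v] would make [D] negative after a small
    step along [v]; the same for [- v] leaves only zero. *)
Lemma diff_eq0_at_zero_min (D : E -> R) x : differentiable D x -> D x = 0 ->
  (forall y, 0 <= D y) -> forall v, 'd D x v = 0.
Proof.
move=> dD Dx0 D0.
suff ge0 v : 0 <= 'd D x v.
  move=> v; apply/eqP; rewrite eq_le ge0 andbT -oppr_ge0 -linearN.
  exact: ge0.
rewrite leNgt; apply/negP => Lv.
have v0 : 0 < `|v|.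
  by rewrite normr_gt0; apply: contraTneq Lv => ->; rewrite linear0 ltxx.
set L := 'd D x v in Lv *.
(* With this tolerance the remainder at [t *: v] is at most half of the linear decrease
   [t * - L]. *)
have eps0 : 0 < - L / (`|v| *+ 2) by rewrite divr_gt0 ?oppr_gt0// mulrn_wgt0.
have /diff_locally/eqaddoP/(_ _ eps0) := dD.
move=> /nbhs_ballP[d /= d0 dP].
(* The step [t *: v] has length [d / 2], so it stays in the ball. *)
pose t := d / (`|v| *+ 2).
have t0 : 0 < t by rewrite divr_gt0// mulrn_wgt0.
have := dP (t *: v); rewrite -ball_normE /= sub0r normrN normrZ gtr0_norm//.
have -> : t * `|v| = d / 2.
  by rewrite /t -(mulr_natl `|v|) invfM mulrA -mulrA mulVf ?mulr1// gt_eqF.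
rewrite gtr_pMr ?invf_lt1 ?ltr1n// => /(_ isT).
rewrite !fctE Dx0 add0r linearZ /= -/L => h.
have Dv := D0 (t *: v + x).
have : t * - L <= t * (- L / 2).
  have -> : t * (- L / 2) = - L / (`|v| *+ 2) * (d / 2).
    by rewrite /t; field; rewrite gt_eqF.
  apply: le_trans h; apply: le_trans (ler_norm _).
  by rewrite mulrN lerDr.
rewrite ler_pM2l//; move: Lv; lra.
Qed.

(** The differential of [D] vanishes at its minimum, so [D] is [o(y - x)]; the bound passes this on
    to [r], whose differential is then zero. *)
Lemma differentiable_squeeze (r D : E -> R) x C :
  differentiable D x -> D x = 0 -> (forall y, 0 <= D y) ->
  (\forall y \near x, `|r y| <= C * D y) -> differentiable r x.
Proof.
move=> dD Dx0 D0 rD.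
have rx0 : r x = 0.
  apply/eqP; rewrite -normr_le0.
  by have := nbhs_singleton rD; rewrite Dx0 mulr0.
have e : r \o shift x = cst (r x) + (\0 : {linear E -> R}) +o_ 0 id.
  apply/eqaddoP => eps eps0.
  (* The added 1 keeps the divisor positive when [C] is zero. *)
  have c0 : 0 < `|C| + 1 by rewrite ltr_wpDl.
  have /diff_locally/eqaddoP/(_ _ (divr_gt0 eps0 c0)) := dD.
  move: rD; rewrite (near_shift 0) /= subr0 => rD; apply: filter_app2 rD.
  near=> h => rh.
  rewrite !fctE Dx0 add0r (diff_eq0_at_zero_min dD Dx0 D0) subr0.
  rewrite rx0 /= add0r subr0.
  rewrite ger0_norm ?D0// mulrAC ler_pdivlMr// => Dh.
  apply: le_trans rh (le_trans _ Dh); rewrite mulrC ler_wpM2l//.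
  by rewrite (le_trans (ler_norm _))// lerDl.
have c0 : continuous (\0 : {linear E -> R}) by apply: dot_linear_continuous.
by apply/diff_locallyP; rewrite (diff_unique c0 e).
Unshelve. all: by end_near. Qed.
End euclidean.

(** * Hermite interpolation of entire functions *)

Section entire.
Context {R : realType}.
Implicit Types (a t M : R) (b : nat -> R).

(** Entire functions are handled through their coefficients, on which division by [t - a] acts
    explicitly. *)
Definition entire b := forall t, cvgn (pseries b t).

Definition psum b t : R := limn (pseries b t).

Lemma pseries_shift b t n :
  pseries b t n.+1 = b 0%N + t * pseries (b \o S) t n.
Proof.
rewrite /pseries /series /= big_nat_recl//= expr0 mulr1; congr (_ + _).
rewrite mulr_sumr; apply: eq_bigr => i _.
by rewrite exprS mulrCA.
Qed.

(** For [t != 0] the shifted partial sums are an affine function of the original ones; at [t = 0]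
    they are eventually constant. *)
Lemma entire_shift b : entire b -> entire (b \o S).
Proof.
move=> cb t; have [->|t0] := eqVneq t 0.
  apply/cvg_ex; exists (b 1%N); apply: cvg_near_cst; near=> n.
  have [m ->] : exists m, n = m.+1.
    by exists n.-1; rewrite prednK//; near: n; exists 1%N.
  by rewrite pseries_shift mul0r addr0.
suff -> : pseries (b \o S) t = (fun n => t^-1 * (pseries b t n.+1 - b 0%N)).
  apply: is_cvgM; first exact: is_cvg_cst.
  apply: is_cvgB; last exact: is_cvg_cst.
  have /cvg_ex[l] := cb t; rewrite -cvg_shiftS => bl.
  by apply/cvg_ex; exists l.
by apply/funext => n; rewrite pseries_shift addrAC subrr add0r mulKf.
Unshelve. all: by end_near. Qed.

Lemma psum_shift b t : entire b ->
  psum b t = b 0%N + t * psum (b \o S) t.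
Proof.
move=> cb; apply: cvg_lim => //; rewrite -cvg_shiftS /=.
under eq_fun do rewrite pseries_shift.
apply: cvgD; first exact: cvg_cst.
by apply: cvgM; [exact: cvg_cst|exact: entire_shift].
Qed.

Lemma entire_norm b : entire b -> entire (fun k => `|b k|).
Proof.
move=> cb t; apply: (@is_cvg_pseries_inside_norm _ _ (`|t| + 1)) => //.
by rewrite [ltRHS]ger0_norm ?addr_ge0// ltrDl.
Qed.

Lemma pseries_le_psum b M n : entire b -> (forall k, 0 <= b k) -> 0 <= M ->
  pseries b M n <= psum b M.
Proof.
move=> cb b0 M0; apply: nondecreasing_cvgn_le => //.
apply/nondecreasing_seqP => k; rewrite /pseries /series /= big_nat_recr//=.
by rewrite lerDl mulr_ge0// exprn_ge0.
Qed.

Lemma psum_bound b t M : entire b -> `|t| <= M ->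
  `|psum b t| <= psum (fun k => `|b k|) M.
Proof.
move=> cb tM; have M0 := le_trans (normr_ge0 _) tM.
have cn : cvgn [normed pseries b t].
  rewrite (_ : [normed _] = pseries (fun k => `|b k|) `|t|).
    exact: entire_norm.
  by apply/funext => n; apply: eq_bigr => k _ /=; rewrite normrM normrX.
apply: le_trans (lim_series_norm cn) _.
apply: limr_le => //; near=> n.
apply: le_trans (pseries_le_psum n _ _ M0) => //; last exact: entire_norm.
apply: ler_sum => k _ /=; rewrite normrM normrX ler_wpM2l//.
by rewrite lerXn2r ?nnegrE.
Unshelve. all: by end_near. Qed.

(** Coefficients of the divided difference [(psum b t - psum b a) / (t - a)], read off from the
    expansion of [(t ^+ m - a ^+ m) / (t - a)] as a sum of [t ^+ i * a ^+ k] over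
    [i + k = m - 1]. *)
Definition psum_div b a : nat -> R := fun i =>
  psum (fun k => b (i.+1 + k)%N) a.

Lemma entire_drop b n : entire b -> entire (fun k => b (n + k)%N).
Proof.
move=> cb; elim: n => [//|n IH]; have := entire_shift IH.
by congr entire; apply/funext => k /=; rewrite addnS.
Qed.

(** Multiplied by [M ^+ i.+1], the series for the coefficient is dominated by the tail from index
    [i.+1] of the series on the right. *)
Lemma psum_div_bound b a M i : entire b -> `|a| <= M ->
  `|psum_div b a i| * M ^+ i.+1 <= psum (fun k => `|b k|) M.
Proof.
move=> cb aM; have M0 := le_trans (normr_ge0 _) aM.
have cbi := entire_drop (n := i.+1) cb.
apply: (@le_trans _ _ (psum (fun k => `|b (i.+1 + k)%N|) M * M ^+ i.+1)).
  by rewrite ler_wpM2r ?exprn_ge0//; exact: psum_bound.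
rewrite mulrC.
set d := (fun k => `|b _|).
have h : (fun n => M ^+ i.+1 * pseries d M n) @ \oo --> M ^+ i.+1 * psum d M.
  by apply: cvgM; [exact: cvg_cst|exact: entire_norm cbi M].
rewrite -(cvg_lim _ h)//; apply: limr_le.
  by apply/cvg_ex; eexists; exact: h.
near=> n.
apply: le_trans (pseries_le_psum (i.+1 + n) _ _ M0) => //; last first.
  exact: entire_norm.
rewrite /pseries /series /= [leRHS](big_cat_nat (n := i.+1)) ?leq_addr//=.
rewrite -[leLHS]add0r lerD//.
  by apply: sumr_ge0 => k _; rewrite mulr_ge0// exprn_ge0.
have -> (F : nat -> R) :
    \sum_(i.+1 <= k < i.+1 + n) F k = \sum_(0 <= k < n) F (k + i.+1)%N.
  by rewrite -{1}[i.+1]add0n big_addn addKn.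
rewrite mulr_sumr.
apply: ler_sum => k _ /=.
by rewrite /d mulrCA -exprD (addnC k).
Unshelve. all: by end_near. Qed.

Lemma entire_psum_div b a : entire b -> entire (psum_div b a).
Proof.
(* [M] dominates [a], is positive, and is at least twice the modulus of [t], so the terms are
   bounded by a geometric series of ratio 1/2. *)
move=> cb t; pose M := `|t| *+ 2 + `|a| + 1.
have aM : `|a| <= M by rewrite /M; have := normr_ge0 t; lra.
have M0 : 0 < M by rewrite /M; have := normr_ge0 t; have := normr_ge0 a; lra.
pose S := psum (fun k => `|b k|) M.
have S0 : 0 <= S.
  apply: (@le_trans _ _ `|psum b M|); first exact: normr_ge0.
  by apply: psum_bound => //; rewrite ger0_norm // ltW.
apply: normed_cvg.
apply: (@series_le_cvg _ _ (geometric (S / M) 2^-1)) => [n|n|n|].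
- exact: normr_ge0.
- by apply: geometric_ge0; [exact: divr_ge0 S0 (ltW M0)|rewrite invr_ge0].
- have := psum_div_bound n cb aM; rewrite -/S => h.
  rewrite /= normrM normrX.
  have tM : `|t| <= 2^-1 * M.
    by rewrite /M; have := normr_ge0 t; have := normr_ge0 a; lra.
  apply: (@le_trans _ _ (`|psum_div b a n| * (2^-1 * M) ^+ n)).
    by rewrite ler_wpM2l// lerXn2r// nnegrE (le_trans _ tM).
  rewrite /geometric/= exprMn mulrCA mulrC ler_wpM2r ?exprn_ge0 ?invr_ge0//.
  by rewrite ler_pdivlMr// -mulrA -exprSr.
- apply: is_cvg_geometric_series; rewrite ger0_norm ?invr_ge0//.
  by rewrite invf_lt1 ?ltr1n.
Qed.

(** Synthetic division: the quotient coefficients satisfy the Horner recurrence [cE]. Summing it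
    against the powers of [t] and eliminating the shifted series gives the identity. *)
Lemma psum_divE b a t : entire b ->
  psum b t = psum b a + (t - a) * psum (psum_div b a) t.
Proof.
move=> cb; set c := psum_div b a.
have cc : entire c := @entire_psum_div _ a cb.
have cE : c = (fun i => b i.+1 + a * c i.+1).
  apply/funext => i; rewrite /c /psum_div psum_shift; last exact: entire_drop.
  rewrite addn0; set d := (X in psum X a); set d' := (X in _ = _ + _ * psum X a).
  by have -> : d = d' by apply/funext => k; rewrite /d /d' /= addnS.
have sc : psum c t = psum (b \o S) t + a * psum (c \o S) t.
  rewrite [in LHS]cE; apply: cvg_lim => //.
  have -> : pseries (fun i => b i.+1 + a * c i.+1) t =
      (fun n => pseries (b \o S) t n + a * pseries (c \o S) t n).
    apply/funext => n; rewrite /pseries /series /= mulr_sumr -big_split.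
    by apply: eq_bigr => i _; rewrite /= mulrDl mulrA.
  apply: cvgD; first exact: entire_shift.
  by apply: cvgM; [exact: cvg_cst|exact: entire_shift].
rewrite (psum_shift t cb) (psum_shift a cb).
have -> : psum (b \o S) a = c 0%N by [].
have := psum_shift t cc; move: sc.
move: (psum c t) (psum (c \o S) t) (psum (b \o S) t) (c 0%N).
move=> x y z w -> h.
rewrite mulrBl {2}h; ring.
Qed.

(* Dividing by [t - a] once per node, with repetitions: this is Hermite
   interpolation at [s], the value of the last quotient bounding the error. *)
Lemma entire_hermite b (s : seq R) : entire b -> exists H : {poly R},
  forall M, exists C, forall t, `|t| <= M ->
    `|psum b t - H.[t]| <= C * `|\prod_(a <- s) (t - a)|.
Proof.
elim: s b => [|a s IH] b cb.
  exists 0 => M; exists (psum (fun k => `|b k|) M) => t tM.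
  by rewrite horner0 subr0 big_nil normr1 mulr1; exact: psum_bound.
have [H HC] := IH _ (@entire_psum_div _ a cb).
exists ((psum b a)%:P + ('X - a%:P) * H) => M.
have [C CH] := HC M; exists C => t tM.
rewrite !hornerE big_cons (psum_divE a t cb).
rewrite opprD addrACA subrr add0r -mulrBr !normrM mulrCA ler_wpM2l//.
exact: CH.
Qed.

Lemma entire_expR (mu : R) :
  exists2 b, entire b & forall t, expR (t / mu) = psum b t.
Proof.
pose b k : R := mu^-1 ^+ k / k`!%:R.
have bE t : pseries b t = series (exp_coeff (t / mu)).
  apply/funext => n; apply: eq_bigr => k _.
  by rewrite /b /exp_coeff/= exprMn mulrAC -mulrA mulrCA mulrA.
exists b => t; first by rewrite bE; exact: is_cvg_series_exp_coeff.
by rewrite /psum bE.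
Qed.
End entire.

(** * Roots and lines *)

(** Over the complex numbers [q] splits, and equal multiplicities make its list of roots a
    permutation of [s]; the factorization descends to the reals because the embedding is
    injective. *)
Lemma roots_with_multiplicityP (R : realType) (q : {poly R}) (s : seq R) :
  q != 0 ->
  roots_with_multiplicity q s <->
  q = lead_coef q *: \prod_(a <- s) ('X - a%:P).
Proof.
move=> q0; set rc := real_complex R.
have mapE (t : seq R) : map_poly rc (\prod_(a <- t) ('X - a%:P)) =
    \prod_(z <- map rc t) ('X - z%:P).
  rewrite rmorph_prod big_map; apply: eq_bigr => a _.
  by rewrite rmorphB /= map_polyX map_polyC.
have mupZ (c : complex R) r z : c != 0 -> mup z (c *: r) = mup z r.
  move=> c0; rewrite -mul_polyC mupMr//.
  by rewrite rootC.
split=> [qs | -> z].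
- have [r qr] := closed_field_poly_normal (map_poly rc q).
  have lq0 : lead_coef (map_poly rc q) != 0.
    by rewrite lead_coef_eq0 map_poly_eq0.
  have : perm_eq (map rc s) r.
    apply/allP => z _ /=; apply/eqP.
    by rewrite qs qr mupZ// mu_prod_XsubC.
  move=> /(perm_big _) => /(_ _ _ _ xpredT (fun z => 'X - z%:P)) sr.
  apply: (map_inj_poly (fmorph_inj rc)); first exact: raddf0.
  by rewrite {1}qr -sr -mapE lead_coef_map map_polyZ.
- rewrite map_polyZ mapE mupZ ?mu_prod_XsubC//.
  by rewrite fmorph_eq0 lead_coef_eq0.
Qed.

Lemma roots_with_multiplicity_perm (R : realType) (q : {poly R}) s t :
  roots_with_multiplicity q s -> roots_with_multiplicity q t -> perm_eq s t.
Proof.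
move=> qs qt; apply: (perm_map_inj (fmorph_inj (real_complex R))).
by apply/allP => z _ /=; rewrite qs qt.
Qed.

Lemma poly_ext (R : numDomainType) (p q : {poly R}) :
  (forall t, p.[t] = q.[t]) -> p = q.
Proof.
move=> pq; apply/eqP; rewrite -subr_eq0; apply/negPn/negP => d0.
(* These are [size (p - q)] distinct roots, one more than the degree allows. *)
pose s := [seq (i%:R : R) | i <- iota 0 (size (p - q))].
have us : uniq s.
  by rewrite map_inj_uniq ?iota_uniq// => i j /eqP; rewrite eqr_nat => /eqP.
have as_ : all (root (p - q)) s.
  by apply/allP => t _; rewrite rootE !hornerE pq subrr.
by have := max_poly_roots d0 as_ us; rewrite size_map size_iota ltnn.
Qed.

(** * Restriction of homogeneous polynomials to lines *)

Section line_polynomial.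
Context {R : realType} {E : euclideanType R}.
Implicit Types (p : E -> R) (e x : E).

Lemma line_poly_uniq p e x (q : {poly R}) :
  (forall t, q.[t] = p (x - t *: e)) -> line_poly p e x = q.
Proof.
move=> qE; apply: poly_ext => t; rewrite qE /line_poly.
by case: xgetP => [r _ /= ->//|/(_ q)]; case.
Qed.

Lemma homogeneous_polynomialZ n p a x : homogeneous_polynomial n p ->
  p (a *: x) = a ^+ n * p x.
Proof.
move=> [P Pn pE]; rewrite !pE !mpoly.mevalE mulr_sumr.
apply: eq_big_seq => m mP.
have /mpoly.dhomogP/(_ _ mP) /= <- := Pn.
rewrite mulrCA; congr (_ * _); rewrite mpoly.mdegE -prodrXr -big_split/=.
by apply: eq_bigr => i _; rewrite linearZ /= exprMn.
Qed.

Lemma homogeneous_polynomial_prod l (n : 'I_l -> nat) (p : 'I_l -> E -> R) :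
  (forall i, homogeneous_polynomial (n i) (p i)) ->
  homogeneous_polynomial (\sum_(i < l) n i) (fun x => \prod_(i < l) p i x).
Proof.
move=> hp; have [P PE] := choice (fun i =>
  let: ex_intro2 P a b := hp i in ex_intro _ P (conj a b)).
exists (\prod_(i < l) P i).
  elim/big_rec2: _ => [|i k Q _ Qk]; first exact: mpoly.dhomog1.
  by apply: mpoly.dhomogM => //; case: (PE i).
move=> x; rewrite rmorph_prod; apply: eq_bigr => i _.
by case: (PE i) => _ ->.
Qed.

(** Working coefficient by coefficient avoids a norm on polynomials and a fixed bound on their
    degree. *)
Definition coef_differentiable (q : E -> {poly R}) x :=
  forall k, differentiable (fun y => (q y)`_k) x.

Lemma coef_differentiable_cst (q : {poly R}) x :
  coef_differentiable (fun=> q) x.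
Proof. by move=> k; exact: differentiable_cst. Qed.

Lemma coef_differentiableM (q r : E -> {poly R}) x :
  coef_differentiable q x -> coef_differentiable r x ->
  coef_differentiable (fun y => q y * r y) x.
Proof.
move=> dq dr k; under eq_fun do rewrite coefM.
apply: differentiable_bigsum => i; exact: differentiableM (dq _) (dr _).
Qed.

Lemma coef_differentiable_sum (I : Type) (s : seq I)
    (q : I -> E -> {poly R}) x :
  (forall i, coef_differentiable (q i) x) ->
  coef_differentiable (fun y => \sum_(i <- s) q i y) x.
Proof.
move=> dq k; under eq_fun do rewrite coef_sum.
by apply: differentiable_bigsum => i; exact: dq.
Qed.

Lemma coef_differentiable_prod (I : Type) (s : seq I)
    (q : I -> E -> {poly R}) x :
  (forall i, coef_differentiable (q i) x) ->
  coef_differentiable (fun y => \prod_(i <- s) q i y) x.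
Proof.
move=> dq; elim: s => [|i s IH].
  by under eq_fun do rewrite big_nil; exact: coef_differentiable_cst.
under eq_fun do rewrite big_cons.
exact: coef_differentiableM.
Qed.

Lemma coef_differentiableX (q : E -> {poly R}) x n :
  coef_differentiable q x -> coef_differentiable (fun y => q y ^+ n) x.
Proof.
move=> dq; rewrite (_ : (fun _ => _) = fun y => \prod_(i < n) q y).
  exact: coef_differentiable_prod.
by apply/funext => y; rewrite prodr_const card_ord.
Qed.

Lemma differentiable_coordinate i x :
  differentiable (fun y : E => coord (vbasis fullv) i y : R) x.
Proof. exact: (@differentiable_linear R E (coord (vbasis fullv) i)). Qed.

(** Substituting [y_i - e_i X] for the variables of [P] gives the polynomial; its coefficients are
    polynomials in the coordinates of [y]. In particular the default value of [line_poly] does not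
    occur. *)
Lemma homogeneous_polynomial_line n p e : homogeneous_polynomial n p ->
  exists2 q : E -> {poly R}, forall y t, (q y).[t] = p (y - t *: e) &
    forall x, coef_differentiable q x.
Proof.
move=> [P _ pE].
exists (fun y => mpoly.mmap (@polyC R)
  (fun i => (coord (vbasis fullv) i y)%:P - coord (vbasis fullv) i e *: 'X) P).
  move=> y t; rewrite pE mpoly.mevalE /mpoly.mmap horner_sum.
  apply: eq_bigr => m _; rewrite hornerM hornerC; congr (_ * _).
  rewrite /mpoly.mmap1 horner_prod; apply: eq_bigr => i _.
  have -> : coord (vbasis fullv) i (y - t *: e) =
      coord (vbasis fullv) i y - t * coord (vbasis fullv) i e.
    by rewrite linearB linearZ.
  by rewrite horner_exp !hornerE mulrC.
move=> x; rewrite /mpoly.mmap; apply: coef_differentiable_sum => m.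
apply: coef_differentiableM; first exact: coef_differentiable_cst.
rewrite /mpoly.mmap1; apply: coef_differentiable_prod => i.
apply: coef_differentiableX => k.
under eq_fun do rewrite coefB coefC.
apply: differentiableB; last exact: differentiable_cst.
by case: eqP => _; [exact: differentiable_coordinate|exact: differentiable_cst].
Qed.

Lemma horner_line_poly n p e x t : homogeneous_polynomial n p ->
  (line_poly p e x).[t] = p (x - t *: e).
Proof.
move=> /homogeneous_polynomial_line-/(_ e)[q qE _].
by rewrite (line_poly_uniq (qE x)).
Qed.

Lemma differentiable_coef_line_poly n p e x : homogeneous_polynomial n p ->
  coef_differentiable (line_poly p e) x.
Proof.
move=> /homogeneous_polynomial_line-/(_ e)[q qE dq].
by rewrite (_ : line_poly p e = q)//; apply/funext => y; exact: line_poly_uniq.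
Qed.

(* [p (e - s *: x)] is a polynomial in [s], nonzero at [0], hence nonzero at
   some [s != 0]; by homogeneity [p (x - s^-1 *: e)] is then nonzero. *)
Lemma line_poly_neq0 n p e x : homogeneous_polynomial n p -> p e != 0 ->
  line_poly p e x != 0.
Proof.
move=> hp pe; pose r := line_poly p x e.
have r0 : r.[0] != 0 by rewrite (horner_line_poly _ _ _ hp) scale0r subr0.
have rn0 : 'X * r != 0.
  rewrite mulf_neq0 ?polyX_eq0//.
  by apply: contraNneq r0 => ->; rewrite horner0.
have [s] : exists s : R, ~~ root ('X * r) s.
  apply: contrapT => /forallNP nr; move/eqP: rn0; apply; apply: poly_ext => t.
  by rewrite horner0; have /negP := nr t; rewrite negbK => /rootP.
rewrite rootM negb_or !rootE hornerX => /andP[s0 rs].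
apply: contraNneq rs => q0.
have := congr1 (fun q => q.[s^-1]) q0.
rewrite horner0 (horner_line_poly _ _ _ hp) (horner_line_poly _ _ _ hp).
have -> : x - s^-1 *: e = (- s^-1) *: (e - s *: x).
  by rewrite scalerBr scalerA mulNr mulVf// scaleN1r opprK addrC scaleNr.
rewrite (homogeneous_polynomialZ _ _ hp) => /eqP.
by rewrite mulf_eq0 expf_eq0 oppr_eq0 invr_eq0 (negPf s0) andbF.
Qed.
End line_polynomial.

(** * Symmetric sums over the roots *)

Lemma sum_horner_mesym (R : comNzRingType) n (H : {poly R}) :
  exists t : mpoly.mpoly n R, forall v : 'I_n -> R,
    \sum_(j < n) H.[v j] =
    mpoly.meval (fun i => mpoly.meval v (mpoly.mesym n R i.+1)) t.
Proof.
pose X j : mpoly.mpoly n R := mpoly.mpolyX R (mpoly.mnm1 j).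
pose P := \sum_(j < n) \sum_(i < size H) H`_i *: X j ^+ i.
have Psym : P \is @mpoly.symmetric n R.
  apply/mpoly.issymP => s; rewrite /P raddf_sum.
  rewrite [RHS](reindex_inj (@perm.perm_inj _ s)).
  apply: eq_bigr => j _; rewrite raddf_sum; apply: eq_bigr => i _.
  rewrite /= mpoly.msymZ rmorphXn; congr (_ *: _ ^+ _).
  by rewrite /X /= /mpoly.msym mpoly.mmapX mpoly.mmap1U.
(* The fundamental theorem of symmetric polynomials writes [P] in the elementary symmetric ones. *)
have [t [tP _]] := mpoly.sym_fundamental Psym.
exists t => v; transitivity (mpoly.meval v P).
  rewrite raddf_sum; apply: eq_bigr => j _; rewrite horner_coef raddf_sum.
  by apply: eq_bigr => i _; rewrite /= mpoly.mevalZ rmorphXn /= mpoly.mevalXU.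
rewrite -tP mpoly.comp_mpoly_meval; apply: mpoly.meval_eq => i.
by rewrite tnth_mktuple.
Qed.

Section symmetric.
Context {R : realType} {E : euclideanType R}.

(** The roots enter only through their elementary symmetric functions, which by Vieta are quotients
    of coefficients of [q y]. *)
Lemma differentiable_sum_horner n (q : E -> {poly R})
    (lam : E -> n.-tuple R) (H : {poly R}) x :
  coef_differentiable q x ->
  (forall y, q y != 0) ->
  (forall y, q y = lead_coef (q y) *: \prod_(a <- lam y) ('X - a%:P)) ->
  differentiable (fun y => \sum_(j < n) H.[tnth (lam y) j]) x.
Proof.
move=> dq q0 qE; have [t tE] := sum_horner_mesym n H.
under eq_fun do rewrite tE mpoly.mevalE.
apply: differentiable_bigsum => m.
apply: differentiableM; first exact: differentiable_cst.
(* The degree is [n] for every [y], so the leading coefficient sits at a fixed index and is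
   differentiable. *)
have lE y : lead_coef (q y) = (q y)`_n.
  rewrite lead_coefE {2}qE size_scale ?lead_coef_eq0//.
  by rewrite size_prod_XsubC size_tuple.
have dprod (F : 'I_n -> E -> R) : (forall i, differentiable (F i) x) ->
    differentiable (fun y => \prod_(i < n) F i y) x.
  elim: (index_enum 'I_n) => [|i r IH] dF.
    by under eq_fun do rewrite big_nil; exact: differentiable_cst.
  by under eq_fun do rewrite big_cons; apply: differentiableM; last exact: IH.
apply: dprod => i.
have dX (f : E -> R) k :
    differentiable f x -> differentiable (fun y => f y ^+ k) x.
  move=> df; elim: k => [|k IH]; first exact: differentiable_cst.
  by under eq_fun do rewrite exprS; exact: differentiableM.
apply: dX; have ki : (i.+1 < n.+1)%N by rewrite ltnS.
(* Vieta's formula for the elementary symmetric function of degree [i.+1]. *)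
rewrite (_ : (fun _ => _) = (fun y =>
    (-1) ^+ i.+1 * ((q y)`_(n - i.+1) * ((q y)`_n)^-1))).
  apply: differentiableM; first exact: differentiable_cst.
  apply: differentiableM; first exact: dq.
  by apply: differentiableV; [exact: dq|rewrite -lE lead_coef_eq0].
apply/funext => y; rewrite {1}qE coefZ -lE mulrAC divff ?lead_coef_eq0// mul1r.
have := mpoly.mroots_coeff (lam y) (Ordinal ki) => /= ->.
by rewrite mulrA -expr2 sqrr_sign mul1r.
Qed.

Lemma differentiable_sum_exp n (q : E -> {poly R})
    (lam : E -> n.-tuple R) (mu : R) x :
  coef_differentiable q x ->
  (forall y, q y != 0) ->
  (forall y, q y = lead_coef (q y) *: \prod_(a <- lam y) ('X - a%:P)) ->
  differentiable (fun y => sum_exp mu (lam y)) x.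
Proof.
move=> dq q0 qE; have dH H := differentiable_sum_horner H dq q0 qE.
have [b eb bE] := entire_expR mu.
(* Listing each node twice makes the error bound a multiple of the square of [m]. *)
have [H HC] := entire_hermite (lam x ++ lam x) eb.
pose m := \prod_(a <- lam x) ('X - a%:P).
(* The roots are locally bounded because the sum of their squares is
   continuous. *)
have bnd : \forall y \near x, forall j,
    `|tnth (lam y) j| <= \sum_(j < n) ('X^2).[tnth (lam x) j] + 1 + 1.
  have := differentiable_continuous (dH 'X^2) => /cvgrPdist_lt /(_ _ ltr01).
  apply: filterS => y yx j.
  set s := \sum_(j < n) _ in yx *.
  set sy := \sum_(j < n) _ in yx.
  have s0 : 0 <= s by apply: sumr_ge0 => i _; rewrite !hornerE sqr_ge0.
  (* With [u] the modulus of the root, [u ^+ 2 <= sy < s + 1] and [u <= u ^+ 2 + 1] give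
     [u <= s + 1 + 1]. *)
  have : tnth (lam y) j ^+ 2 <= sy.
    rewrite /sy (bigD1 j)//= !hornerE lerDl.
    by apply: sumr_ge0 => i _; rewrite !hornerE sqr_ge0.
  rewrite -(real_normK (num_real (tnth _ _))).
  move: yx; rewrite ltr_norml => /andP[]; move: (normr_ge0 (tnth (lam y) j)).
  by move: `|tnth _ _| => u; nra.
set M := _ + 1 in bnd; have [C CH] := HC M.
(* The sum splits into the interpolant's part, a polynomial sum, and the interpolation error,
   squeezed by [D]. *)
rewrite (_ : (fun _ => _) = (fun y => \sum_(j < n) H.[tnth (lam y) j]) +
   (fun y => \sum_(j < n) (psum b (tnth (lam y) j) - H.[tnth (lam y) j])));
  last first.
  apply/funext => y; rewrite !fctE -big_split/= /sum_exp big_tuple.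
  by apply: eq_bigr => j _; rewrite addrC subrK bE.
apply: differentiableD; first exact: dH.
pose D y := \sum_(j < n) (m ^+ 2).[tnth (lam y) j].
apply: (@differentiable_squeeze _ _ _ D _ C).
- exact: dH.
- apply: big1 => j _; rewrite horner_exp; apply/eqP; rewrite sqrf_eq0 -rootE.
  by rewrite root_prod_XsubC mem_tnth.
- by move=> y; apply: sumr_ge0 => j _; rewrite horner_exp sqr_ge0.
- apply: filterS bnd => y yM.
  apply: le_trans (ler_norm_sum _ _ _) _; rewrite mulr_sumr.
  apply: ler_sum => j _; apply: le_trans (CH _ (yM j)) _.
  rewrite big_cat/= -expr2 normrX real_normK ?num_real// horner_exp.
  rewrite /m horner_prod.
  by under [X in _ <= C * X ^+ 2]eq_bigr do rewrite hornerXsubC.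
Qed.
End symmetric.

(** * Hyperbolicity cones *)

Section convexity.
Context {R : realType} {E : normedModType R}.
Implicit Types (A : set E) (x y : E) (t : R).

Lemma convex_setP A : convex_set A <->
  forall x y t, A x -> A y -> 0 <= t <= 1 -> A (t *: x + (1 - t) *: y).
Proof.
split=> [cA x y t Ax Ay /andP[t0 t1]|cA x y t].
  have := cA x y (Itv01 t0 t1); rewrite !inE => /(_ Ax Ay).
  by [].
rewrite !inE => Ax Ay; apply: cA => //; apply/andP; split=> //.
Qed.

(** Translating both endpoints by the same [h] translates their convex combination by [h], so the
    smaller of the two radii works. *)
Lemma convex_interior A : convex_set A -> convex_set A°.
Proof.
move=> /convex_setP cA; apply/convex_setP => x y t.
move=> /nbhs_ballP[d /= d0 xA] /nbhs_ballP[d' /= d'0 yA] t01.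
apply/nbhs_ballP; exists (Num.min d d') => /=; first by rewrite lt_min d0.
move=> z; rewrite -ball_normE /= lt_min => /andP[zd zd'].
have shift h : t *: (x - h) + (1 - t) *: (y - h) = t *: x + (1 - t) *: y - h.
  rewrite !scalerBr addrACA -opprD -scalerDl addrC (addrC t) subrK.
  by rewrite scale1r addrC.
pose h := t *: x + (1 - t) *: y - z.
have -> : z = t *: (x - h) + (1 - t) *: (y - h) by rewrite shift subKr.
by apply: cA => //; [apply: xA|apply: yA]; rewrite -ball_normE /= subKr.
Qed.

(** A nonempty convex set is a union of segments sharing the endpoint [a]. *)
Lemma convex_connected A : convex_set A -> connected A.
Proof.
move=> /convex_setP cA.
have [->|/set0P[a Aa]] := eqVneq A set0; first exact: connected0.
pose seg y := (fun t : R => t *: y + (1 - t) *: a) @` `[0, 1].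
have -> : A = \bigcup_(y in A) seg y.
  apply/seteqP; split=> [y Ay|_ [y Ay [t /= t01 <-]]].
    exists y => //; exists 1; first by rewrite /= in_itv/= lexx ler01.
    by rewrite scale1r subrr scale0r addr0.
  by apply: cA => //; move: t01; rewrite in_itv.
apply: bigcup_connected.
  exists a => y Ay; exists 0; first by rewrite /= in_itv/= lexx ler01.
  by rewrite scale0r subr0 scale1r add0r.
move=> y Ay; apply: connected_continuous_connected.
  exact: segment_connected.
apply: continuous_subspaceT => t.
apply: cvgD; apply: cvgZ; try exact: cvg_cst; first exact: cvg_id.
by apply: cvgB; [exact: cvg_cst|exact: cvg_id].
Qed.

Lemma interior_bigcap l (K : 'I_l -> set E) :
  (\bigcap_i K i)° = \bigcap_i (K i)°.
Proof.
apply/seteqP; split=> x.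
  by move=> xK i _; move: xK; apply: interiorS => y; exact.
move=> xK; have : \forall y \near x, forall i, K i y.
  by apply: filter_forall => i; exact: xK.
by apply: filterS => y yK i _; exact: yK.
Qed.

End convexity.

Section main.
Context {R : realType} {E : euclideanType R}.

(** A complex root has positive multiplicity, hence occurs among the embedded reals of [s]. *)
Lemma real_rooted_roots (q : {poly R}) s :
  q != 0 -> roots_with_multiplicity q s -> real_rooted q.
Proof.
move=> q0 qs z qz; have : z \in map (real_complex R) s.
  rewrite -has_pred1 has_count qs -XsubC_dvd ?dvdp_XsubCl//.
  by rewrite map_poly_eq0.
by move=> /mapP[a _ ->].
Qed.

Lemma hyperbolicity_cone_component K n (p : E -> R) e :
  hyperbolicity_cone K n p -> K° e ->
  K° = connected_component [set y | p y != 0] e.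
Proof.
move=> /hyp_component[x _ ->]; exact: same_connected_component.
Qed.

Lemma hyperbolicity_cone_neq0 K n (p : E -> R) e :
  hyperbolicity_cone K n p -> K° e -> p e != 0.
Proof.
move=> hK Ke; have := Ke; rewrite (hyperbolicity_cone_component hK Ke).
exact: connected_component_sub.
Qed.

(** In degree 0 the polynomial would be a nonzero constant and its component the whole space,
    against properness. Each list of eigenvalues is therefore nonempty, which keeps the logarithms
    meaningful. *)
Lemma hyperbolicity_cone_degree_gt0 K n (p : E -> R) :
  hyperbolicity_cone K n p -> (0 < n)%N.
Proof.
move=> hK; rewrite lt0n; apply/eqP => n0.
have [e Ke] := hyp_solid hK.
have pc y : p y = p 0.
  have := homogeneous_polynomialZ 0 y (hyp_homogeneous hK).
  by rewrite n0 expr0 mul1r scale0r.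
have pT : [set y | p y != 0] = setT.
  apply/seteqP; split=> // y _ /=; rewrite pc -(pc e).
  exact: hyperbolicity_cone_neq0 hK Ke.
have cT : connected [set: E] by apply: convex_connected; apply/convex_setP.
have [_] := hyp_proper hK; apply => y _.
apply: interior_subset; rewrite (hyperbolicity_cone_component hK Ke) pT.
exact: (connected_component_max (B := setT)).
Qed.

(** * Products of hyperbolic polynomials and intersections of cones *)

Section product.
Variables (l : nat) (K : 'I_l -> set E) (n : 'I_l -> nat) (p : 'I_l -> E -> R).
Hypothesis Kp : forall i, hyperbolicity_cone (K i) (n i) (p i).
Variable e : E.
Hypothesis Ke : forall i, (K i)° e.

Lemma line_poly_prod x :
  line_poly (fun y => \prod_(i < l) p i y) e x =
  \prod_(i < l) line_poly (p i) e x.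
Proof.
apply: line_poly_uniq => t; rewrite horner_prod; apply: eq_bigr => i _.
exact: horner_line_poly (hyp_homogeneous (Kp i)).
Qed.

Lemma cone_line_poly_neq0 i x : line_poly (p i) e x != 0.
Proof.
apply: line_poly_neq0; first exact: hyp_homogeneous (Kp i).
exact: hyperbolicity_cone_neq0 (Kp i) (Ke i).
Qed.

Lemma line_poly_prod_neq0 x :
  line_poly (fun y => \prod_(i < l) p i y) e x != 0.
Proof.
rewrite line_poly_prod; apply/prodf_neq0 => i _; exact: cone_line_poly_neq0.
Qed.

(** Multiplying the factorizations into linear factors concatenates the lists of roots and
    multiplies the leading coefficients. *)
Lemma eigenvalues_prod x (s : 'I_l -> seq R) :
  (forall i, eigenvalues (p i) e x (s i)) ->
  eigenvalues (fun y => \prod_(i < l) p i y) e x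
    (flatten [seq s i | i <- enum 'I_l]).
Proof.
move=> ps; apply/(roots_with_multiplicityP _ (line_poly_prod_neq0 x)).
rewrite line_poly_prod lead_coef_prod big_flatten big_map big_enum/=.
rewrite -scaler_prod; apply: eq_bigr => i _.
by apply/(roots_with_multiplicityP _ (cone_line_poly_neq0 i x)); exact: ps.
Qed.

Lemma hyperbolicity_cone_bigcap (s : 'I_l -> E -> seq R) : (0 < l)%N ->
  (forall i x, eigenvalues (p i) e x (s i x)) ->
  hyperbolicity_cone (\bigcap_i K i) (\sum_(i < l) n i)
    (fun y => \prod_(i < l) p i y).
Proof.
move=> l0 ps.
have Ki : (\bigcap_i K i)° e by rewrite interior_bigcap => i _.
have pe : \prod_(i < l) p i e != 0.
  by apply/prodf_neq0 => i _; exact: hyperbolicity_cone_neq0 (Kp i) (Ke i).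
have cK : convex_set (\bigcap_i K i).
  apply/convex_setP => x y t Kx Ky t01 i _.
  by move/convex_setP: (hyp_convex (Kp i)); apply => //; [exact: Kx|exact: Ky].
split.
- by apply: closed_bigI => i _; exact: hyp_closed (Kp i).
- exact: cK.
- by move=> a x a0 Kx i _; apply: (hyp_cone (Kp i)) => //; exact: Kx.
- split=> // KT; have [_] := hyp_proper (Kp (Ordinal l0)); apply => x Tx.
  exact: KT Tx _ I.
- by exists e.
- by apply: homogeneous_polynomial_prod => i; exact: hyp_homogeneous (Kp i).
- exists e => //; apply/seteqP; split.
    (* The interior of the intersection is connected, contains [e] and avoids the zeros of the
       product. *)
    apply: connected_component_max => //.
    + rewrite interior_bigcap => y yK; apply/prodf_neq0 => i _.
      exact: hyperbolicity_cone_neq0 (Kp i) (yK i I).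
    + exact/convex_connected/convex_interior.
  (* Conversely, the component of the product is connected, contains [e] and avoids the zeros of
     each [p i]. *)
  rewrite interior_bigcap => y cy i _.
  rewrite (hyperbolicity_cone_component (Kp i) (Ke i)).
  move: y cy; apply: connected_component_max => //.
  + exact: connected_component_refl.
  + move=> y /connected_component_sub /= py; apply: contraNneq py => py.
    by rewrite (bigD1 i)//= py mul0r.
  + exact: component_connected.
(* Each cone is real-rooted along some interior direction by definition; along the common [e] the
   given eigenvalue lists supply it. *)
- exists e => // x; apply: real_rooted_roots (line_poly_prod_neq0 x) _.
  by apply: eigenvalues_prod => i; exact: ps.
Qed.
End product.

End main.

(** * Gradient of the log-sum-exp of all eigenvalues *)

Theorem proposition3p2 (R : realType) (E : euclideanType R)
    (l : nat) (l_gt0 : (0 < l)%N)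
    (K : 'I_l -> set E) (n : 'I_l -> nat) (p : 'I_l -> E -> R)
    (Kp : forall i, hyperbolicity_cone (K i) (n i) (p i))
    (e : E) (Ke : forall i, (K i)° e)
    (lam : forall i : 'I_l, E -> (n i).-tuple R)
    (lamE : forall i x, eigenvalues (p i) e x (lam i x))
    (mu : R) (mu_gt0 : 0 < mu) :
  let pprod := fun x : E => \prod_(i < l) p i x in
  let union := fun x : E => flatten [seq tval (lam i x) | i <- enum 'I_l] in
  let f := fun (i : 'I_l) (x : E) => log_sum_exp mu (lam i x) in
  let S := fun (i : 'I_l) (x : E) => \sum_(j < n i) expR (tnth (lam i x) j / mu) in
  [/\ hyperbolicity_cone (\bigcap_i K i) (\sum_(i < l) n i) pprod,
      forall x, eigenvalues pprod e x (union x) &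
      forall Lam : E -> seq R,
        (forall x, eigenvalues pprod e x (Lam x)) ->
        let fmu := fun x : E => log_sum_exp mu (Lam x) in
        forall x,
          [/\ perm_eq (Lam x) (union x),
              forall i, differentiable (f i) x,
              differentiable fmu x,
              gradient fmu x =
                (\sum_(i < l) S i x)^-1 *:
                  \sum_(i < l) S i x *: gradient (f i) x &
              (forall i, 0 <= (\sum_(k < l) S k x)^-1 * S i x) /\
              \sum_(i < l) (\sum_(k < l) S k x)^-1 * S i x = 1]].
Proof.
move=> pprod union f S.
have SE i : S i = fun y => sum_exp mu (lam i y).
  by apply/funext => y; rewrite /S /sum_exp big_tuple.
have fE i : f i = fun y => mu * ln (S i y) by rewrite SE.
have S_gt0 i x : 0 < S i x.
  have n0 := hyperbolicity_cone_degree_gt0 (Kp i).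
  rewrite /S (bigD1 (Ordinal n0))//= ltr_pwDl ?expR_gt0//.
  by apply: sumr_ge0 => j _; exact: expR_ge0.
have dS i x : differentiable (S i) x.
  rewrite SE.
  apply: (differentiable_sum_exp (q := line_poly (p i) e)) => [|y|y].
  - exact: differentiable_coef_line_poly (hyp_homogeneous (Kp i)).
  - exact: (cone_line_poly_neq0 Kp Ke i y).
  - apply/(roots_with_multiplicityP _ (cone_line_poly_neq0 Kp Ke i y)).
    exact: lamE.
have unionE x : eigenvalues pprod e x (union x).
  by apply: eigenvalues_prod => // i; exact: lamE.
split=> [|//|Lam LamE fmu x].
  exact: (hyperbolicity_cone_bigcap Kp Ke (s := fun i x => lam i x)).
pose T y := \sum_(i < l) S i y.
have T_gt0 : 0 < T x.
  rewrite /T (bigD1 (Ordinal l_gt0))//= ltr_pwDl//.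
  by apply: sumr_ge0 => i _; exact: ltW.
(* Any listing [Lam] is determined up to order, so sums over it can be taken over [union]. *)
have permL y : perm_eq (Lam y) (union y).
  exact: roots_with_multiplicity_perm (LamE y) (unionE y).
have fmuE : fmu = fun y => mu * ln (T y).
  apply/funext => y; rewrite /fmu /log_sum_exp /sum_exp (perm_big _ (permL y)).
  rewrite big_flatten big_map big_enum/=; congr (_ * ln _).
  by apply: eq_bigr => i _; rewrite SE.
have [dT dTE] : is_diff x T _ := diff_sum (index_enum 'I_l) (fun i => dS i x).
have df i : differentiable (f i) x /\
    forall v, 'd (f i) x v = mu / S i x * 'd (S i) x v.
  by rewrite fE; exact: diff_log.
split => //.
- by move=> i; exact: (df i).1.
- by rewrite fmuE; exact: (diff_log mu dT T_gt0).1.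
- apply: gradient_uniq => v; rewrite fmuE (diff_log mu dT T_gt0).2 dTE.
  rewrite dotZl dot_suml mulrC [mu / _]mulrC mulrCA -/(T x); congr (_ * _).
  (* Termwise, the weight [S i x] cancels the denominator of [mu / S i x] in the differential of
     [f i]. *)
  rewrite mulr_suml; apply: eq_bigr => i _.
  rewrite dotZl -gradientE (df i).2.
  by field; rewrite gt_eqF.
- split=> [i|]; first by rewrite mulr_ge0 ?invr_ge0 ?ltW.
  by rewrite -mulr_sumr mulVf// gt_eqF.
Qed.
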